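(* Let $n\ge 1$, let $U$ be an $n\times n$ complex unitary matrix, and let $0\le r\le n$. Let $z_1,\dots,z_n,w_1,\dots,w_n$ be mutually independent random variables, each distributed according to the normalized Haar measure on the unit circle $\mathbb{T}=\{z\in\mathbb{C}:|z|=1\}$, and put $E_z=\mathrm{diag}(z_1,\dots,z_n)$ and $E_w=\mathrm{diag}(w_1,\dots,w_n)$. Then $$\delta_r(U)=\mathbb{E}\left|\mathsf{e}_r(E_zUE_wU^* )-\frac{\mathsf{e}_r(E_z)\,\mathsf{e}_r(E_w)}{N_{n,r}}\right|^2.$$ Equivalently, $\delta_r(U)=\left\|\mathsf{e}_r(E_zUE_wU^* )-\frac{\mathsf{e}_r(E_z)\mathsf{e}_r(E_w)}{N_{n,r}}\right\|_{L^2(\mathbb{T}^{2n})}^2$, where $\mathbb{T}^{2n}$ carries the normalized Haar measure.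
   Context: Notation: $[n]=\{1,\dots,n\}$, $N_{n,r}=\binom{n}{r}$, and $A[I,J]$ is the submatrix of $A$ with row set $I$ and column set $J$. For an $n\times n$ complex matrix $A$, $\mathsf{e}_r(A)=\sum_{I\subset[n],\,|I|=r}\det A[I,I]$ for $1\le r\le n$ and $\mathsf{e}_0(A)=1$, so that the characteristic polynomial is $\chi_A(x)=\sum_{r=0}^n(-1)^r\mathsf{e}_r(A)x^{n-r}$. For an $n\times n$ unitary matrix $U$ and $1\le r\le n$, the $r$-th uniform-minor discrepancy is $$\delta_r(U)=\sum_{\substack{I,J\subset[n]\\|I|=|J|=r}}\left(|\det U[I,J]|^2-\frac{1}{N_{n,r}}\right)^2,$$ and $\delta_0(U)=0$. *)

(* Defs.v *)
From HB Require Import structures.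
From mathcomp Require Import all_boot all_order all_algebra.
From mathcomp Require Import complex.
From mathcomp Require Import all_classical all_reals all_analysis.

Set Implicit Arguments.
Unset Strict Implicit.
Unset Printing Implicit Defensive.

Import Order.TTheory GRing.Theory Num.Theory.

Local Open Scope classical_set_scope.
Local Open Scope ring_scope.
Local Open Scope sesquilinear_scope.

Section minors.
Variables (K : comNzRingType) (n : nat).
Implicit Types (A : 'M[K]_n) (I J : {set 'I_n}).

(* [enum_val] lists a subset of 'I_n in increasing order.  [conform_mx] retypes
   the #|I| x #|J| submatrix A[I,J] as a square one when #|I| = #|J| (see
   [minorE]); the value for #|I| != #|J| is irrelevant. *)
Definition minor A I J : K :=
  \det (conform_mx (0 : 'M[K]_#|I|)
    (mxsub (fun i : 'I_#|I| => enum_val i) (fun j : 'I_#|J| => enum_val j) A)).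

Lemma minorE A I J (eIJ : #|I| = #|J|) :
  minor A I J =
  \det (\matrix_(i < #|I|, j < #|I|) A (enum_val i) (enum_val (cast_ord eIJ j))).
Proof.
rewrite /minor -(conform_castmx (erefl #|I|, esym eIJ)) conform_mx_id.
by congr (\det _); apply/matrixP => i j; rewrite castmxE !mxE /= esymK cast_ord_id.
Qed.

Definition e_ (r : nat) A : K := \sum_(I : {set 'I_n} | #|I| == r) minor A I I.

Lemma minor00 A : minor A finset.set0 finset.set0 = 1.
Proof.
rewrite /minor; move: (conform_mx _ _); rewrite cards0 => B; exact: det_mx00.
Qed.

Lemma e_0 A : e_ 0 A = 1.
Proof.
rewrite /e_ (eq_bigl (pred1 finset.set0)) ?big_pred1_eq ?minor00 // => I.
by rewrite /= cards_eq0.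
Qed.

End minors.

Section discrepancy.
Variables (R : realType) (n : nat).
Implicit Type U : 'M[R[i]]_n.

(* [normc z : R] is the modulus of [z] ([`|z|] is its image in R[i]). *)
Definition delta (r : nat) U : R :=
  \sum_(I : {set 'I_n} | #|I| == r) \sum_(J : {set 'I_n} | #|J| == r)
    (ComplexField.Normc.normc (minor U I J) ^+ 2 - ('C(n, r)%:R)^-1) ^+ 2.

Lemma delta0 U : delta 0 U = 0.
Proof.
rewrite /delta; apply: big1 => I; rewrite cards_eq0 => /eqP ->.
apply: big1 => J; rewrite cards_eq0 => /eqP ->.
by rewrite minor00 bin0 ComplexField.Normc.normc1 expr1n invr1 subrr expr0n.
Qed.

End discrepancy.

Section circle.
Variable R : realType.

Record circle : Type := Circle { cval :> R[i]; _ : `|cval| == 1 }.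

HB.instance Definition _ := [isSub for cval].
HB.instance Definition _ := [Choice of circle by <:].

Fact circle1_subproof : `|1 : R[i]| == 1. Proof. by rewrite normr1. Qed.

HB.instance Definition _ := isPointed.Build circle (Circle circle1_subproof).

(* The Borel sigma-algebra of the circle, as a subspace of C = R^2. *)
Definition circle_coord (x : circle) : R * R :=
  (complex.Re (cval x), complex.Im (cval x)).

HB.instance Definition _ :=
  Measurable.copy circle (g_sigma_algebra_preimageType circle_coord).

Fact circle_mul_subproof (x y : circle) : `|cval x * cval y| == 1.
Proof. by rewrite normrM (eqP (valP x)) (eqP (valP y)) mulr1. Qed.

Definition circle_mul (x y : circle) : circle := Circle (circle_mul_subproof x y).

Definition torus_mul m (x y : m.-tuple circle) : m.-tuple circle :=
  [tuple circle_mul (tnth x k) (tnth y k) | k < m].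

End circle.

(* The normalized Haar measure of a compact group with multiplication [mul] is
   its translation-invariant probability measure; on the second countable
   groups used here (circle and torus) regularity is automatic. *)
Definition is_haar d (G : measurableType d) (R : realType) (mul : G -> G -> G)
    (mu : probability G R) : Prop :=
  forall (u : G) (A : set G), measurable A -> mu (mul u @^-1` A) = mu A.

Definition mutually_independent d d' (T : measurableType d)
    (T' : measurableType d') (R : realType) (P : probability T R)
    (I : finType) (X : I -> {RV P >-> T'}) : Prop :=
  forall (J : {set I}) (A : I -> set T'), (forall i, measurable (A i)) ->
    P (\bigcap_(i in [set` J]) (X i @^-1` A i)) =
    (\prod_(i in J) P (X i @^-1` A i))%E.

Section esym_gap.
Variables (R : realType) (n : nat).

Definition E_ (z : 'I_n -> circle R) : 'M[R[i]]_n :=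
  diag_mx (\row_i cval (z i)).

Definition esym_gap (r : nat) (U : 'M[R[i]]_n) (z w : 'I_n -> circle R) : R[i] :=
  e_ r (E_ z *m U *m E_ w *m U ^t*) - e_ r (E_ z) * e_ r (E_ w) / 'C(n, r)%:R.

End esym_gap.

(* Main.v *)
Require Import Defs.
From HB Require Import structures.
From mathcomp Require Import all_boot all_order all_fingroup all_algebra.
From mathcomp Require Import complex ring.
From mathcomp Require Import all_classical all_reals all_analysis.
From mathcomp Require Import measurable_realfun.

(** By the Cauchy-Binet formula, together with the fact that the J, I minor of
    the adjoint of U is the conjugate of the I, J minor of U,
      e_r(E_z U E_w U^* ) = sum_{I,J} |det U[I,J]|^2 z_I w_J,
    where z_I denotes the product of the z_i for i in I.  Since e_r(E_z) is the
    sum of the z_I, the random variable in the theorem is the polynomial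
      sum_{I,J} (|det U[I,J]|^2 - 1/N) z_I w_J          (esym_gap_expansion)
    on the torus, and delta_r(U) is the sum of the squares of its coefficients.
    The identity is therefore Parseval's: the monomials z_I w_J are distinct
    characters of the torus, hence orthonormal for Haar measure.

    Integrating characters can be avoided because these monomials are
    multilinear: the subgroup {1,-1}^{2n} of the torus already separates them.
    By finite Parseval on that subgroup (walsh_parseval) the average of
    |Q(s t)|^2 over all sign vectors s is, for every single point t, the sum of
    the |c|^2 over the coefficients c of Q (sum_sign_torus_poly).  Integrating
    in t and using that Haar measure is invariant under translation by each s
    gives Parseval on the torus (torus_parseval); only nonnegative functions
    are integrated.

    This settles the L^2 form of the statement.  The form with random variables
    reduces to it: the joint law of independent Haar distributed variables is
    invariant under translations of the torus, since a translation multiplies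
    each side of a box by a point of the circle and boxes determine a
    probability measure (joint_haar). *)

Set Implicit Arguments.
Unset Strict Implicit.
Unset Printing Implicit Defensive.

Import Order.TTheory GRing.Theory Num.Theory.

Local Open Scope classical_set_scope.
Local Open Scope ring_scope.

(** * Cauchy-Binet for minors *)

(** Multilinearity of the determinant in the rows of A *m B, each of which is a
    combination of rows of B.  As A need not be square, f is not restricted to
    permutations; the f that are not injective drop out by
    [det_row_reindex_notinj]. *)
Lemma det_mulmx_ffun (K : comNzRingType) (m n : nat)
    (A : 'M[K]_(m, n)) (B : 'M[K]_(n, m)) :
  \det (A *m B) = \sum_(f : {ffun 'I_m -> 'I_n})
    (\prod_i A i (f i)) * \det (\matrix_(i, j) B (f i) j).
Proof.
rewrite /determinant.
transitivity (\sum_(s : 'S_m) \sum_(f : {ffun 'I_m -> 'I_n})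
    (-1) ^+ s * \prod_i (A i (f i) * B (f i) (s i))).
  apply: eq_bigr => s _.
  rewrite -big_distrr -(bigA_distr_bigA (fun i j => A i j * B j (s i))) /=.
  by congr (_ * _); apply: eq_bigr => i _; rewrite mxE.
rewrite exchange_big; apply: eq_bigr => /= f _; rewrite big_distrr /=.
apply: eq_bigr => s _; rewrite big_split /= mulrCA; congr (_ * (_ * _)).
by apply: eq_bigr => i _; rewrite mxE.
Qed.

Lemma det_row_reindex_notinj (K : comNzRingType) (m n : nat)
    (B : 'M[K]_(n, m)) (f : {ffun 'I_m -> 'I_n}) :
  ~~ injectiveb f -> \det (\matrix_(i, j) B (f i) j) = 0.
Proof.
case/injectivePn => i1 [i2 ne12 ef12].
by rewrite (determinant_alternate ne12) // => j; rewrite !mxE ef12.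
Qed.

(** The maps onto a set J of size m are g followed by a permutation of 'I_m,
    where g is any enumeration of J; the sign of that permutation comes out of
    the second determinant and turns the sum into the Leibniz formula for the
    first one. *)
Lemma sum_ffun_imset (K : comNzRingType) (m n : nat)
    (A : 'M[K]_(m, n)) (B : 'M[K]_(n, m)) (g : 'I_m -> 'I_n) (J : {set 'I_n}) :
  injective g -> g @: 'I_m = J ->
  \sum_(f : {ffun 'I_m -> 'I_n} | f @: 'I_m == J)
    (\prod_i A i (f i)) * \det (\matrix_(i, j) B (f i) j) =
  \det (\matrix_(i, j) A i (g j)) * \det (\matrix_(i, j) B (g i) j).
Proof.
move=> g_inj gJ.
(* [ind f] solves f = g \o ind f; the default i is never reached when the image
   of f is J. *)
pose ind (f : {ffun 'I_m -> 'I_n}) : {ffun 'I_m -> 'I_m} :=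
  [ffun i => odflt i [pick j | g j == f i]].
pose h (s : 'S_m) : {ffun 'I_m -> 'I_n} := [ffun i => g (s i)].
pose h' f : 'S_m := insubd (1%g : 'S_m) (ind f).
have indE (f : {ffun 'I_m -> 'I_n}) i : f @: 'I_m = J -> g (ind f i) = f i.
  move=> fJ; rewrite ffunE; case: pickP => [j /eqP //|].
  have : f i \in g @: 'I_m by rewrite gJ -fJ imset_f.
  by case/imsetP => j _ -> /(_ j); rewrite eqxx.
have imJ (f : {ffun 'I_m -> 'I_n}) : f @: 'I_m = J -> injective f.
  move=> fJ; have /imset_injP inj : #|f @: 'I_m| == #|'I_m|.
    by rewrite fJ -gJ card_imset.
  by move=> i j /inj; apply.
have h'E (f : {ffun 'I_m -> 'I_n}) : f @: 'I_m = J -> pval (h' f) = ind f.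
  move=> fJ; apply: insubdK; apply/injectiveP => i j eij.
  by apply: (imJ f fJ); rewrite -(indE f i fJ) eij indE.
rewrite (reindex_onto h h') /=; last first.
  move=> f /eqP fJ; apply/ffunP => i; rewrite ffunE -[RHS](indE f i fJ).
  by rewrite -(h'E f fJ) pvalE.
have hJ s : h s @: 'I_m = J.
  rewrite -gJ; apply/setP => x; apply/imsetP/imsetP => -[i _ ->].
    by exists (s i) => //; rewrite ffunE.
  by exists (s^-1%g i) => //; rewrite ffunE permKV.
rewrite [\det (\matrix_(i, j) A i (g j))]/determinant big_distrl /=.
apply: eq_big => [s | s _].
  rewrite hJ eqxx /=; apply/eqP; apply/permP => i; apply: g_inj.
  by have := indE (h s) i (hJ s); rewrite -(h'E _ (hJ s)) pvalE ffunE.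
have -> : \matrix_(i, j) B (h s i) j = row_perm s (\matrix_(i, j) B (g i) j).
  by apply/matrixP => i j; rewrite !mxE ffunE.
rewrite row_permE det_mulmx det_perm mulrCA mulrA; congr (_ * _ * _).
by apply: eq_bigr => i _; rewrite mxE ffunE.
Qed.

(** Leaves the size m free, so that minors whose row and column sets are
    different sets of the same size can be compared as m x m determinants. *)
Lemma minor_cast (K : comNzRingType) (n m : nat) (A : 'M[K]_n)
    (I J : {set 'I_n}) (eI : m = #|I|) (eJ : m = #|J|) :
  minor A I J = \det (\matrix_(i < m, j < m)
    A (enum_val (cast_ord eI i)) (enum_val (cast_ord eJ j))).
Proof.
subst m; rewrite (minorE A eJ); congr (\det _).
by apply/matrixP => i j; rewrite !mxE cast_ord_id.
Qed.

Lemma imset_enum_val_cast (n m : nat) (J : {set 'I_n}) (eJ : m = #|J|) :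
  [set enum_val (cast_ord eJ j) | j in 'I_m]%SET = J.
Proof.
subst m; apply/setP => x; apply/imsetP/idP => [[j _ ->]|xJ].
  exact: enum_valP.
exists (enum_rank_in xJ x) => //.
by rewrite cast_ord_id enum_rankK_in.
Qed.

(** The Cauchy-Binet formula for principal minors: the injective maps in
    [det_mulmx_ffun] are grouped by their image J. *)
Lemma minor_mulmx (K : comNzRingType) (n : nat) (A B : 'M[K]_n)
    (I : {set 'I_n}) :
  minor (A *m B) I I =
  \sum_(J : {set 'I_n} | #|J| == #|I|) minor A I J * minor B J I.
Proof.
rewrite (minor_cast _ erefl erefl).
pose g := fun i : 'I_#|I| => enum_val i.
transitivity (\det (rowsub g A *m colsub g B)).
  congr (\det _); apply/matrixP => i j; rewrite !mxE.
  by apply: eq_bigr => k _; rewrite !mxE !cast_ord_id.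
rewrite det_mulmx_ffun.
rewrite (bigID (fun f : {ffun 'I_#|I| -> 'I_n} => injectiveb f)) /=.
rewrite addrC big1 ?add0r.
  rewrite (partition_big (fun f : {ffun _ -> _} => f @: 'I_#|I|)
    (fun J : {set 'I_n} => #|J| == #|I|)) /=; last first.
    by move=> f /injectiveP f_inj; rewrite card_imset // card_ord.
  apply: eq_bigr => J /eqP cJ; have eJ := esym cJ.
  rewrite (minor_cast A erefl eJ) (minor_cast B eJ erefl).
  have := sum_ffun_imset (rowsub g A) (colsub g B)
    (inj_comp enum_val_inj (@cast_ord_inj _ _ eJ)) (imset_enum_val_cast eJ).
  move=> eS; transitivity (\det (\matrix_(i, j) rowsub g A i
     ((enum_val \o cast_ord eJ) j)) *
     \det (\matrix_(i, j) colsub g B ((enum_val \o cast_ord eJ) i) j)).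
    rewrite -{}eS; apply: eq_bigl => f; rewrite andb_idl // => /eqP fJ.
    have /imset_injP inj : #|f @: 'I_(#|I|)| == #|'I_(#|I|)|.
      by rewrite fJ cJ card_ord.
    by apply/injectiveP => i j /inj; apply.
  by congr (_ * _); congr (\det _); apply/matrixP => i j;
    rewrite !mxE cast_ord_id.
by move=> f /det_row_reindex_notinj ->; rewrite mulr0.
Qed.

Lemma prod_enum_val_cast (K : comNzRingType) (n m : nat) (J : {set 'I_n})
    (eJ : m = #|J|) (F : 'I_n -> K) :
  \prod_(j < m) F (enum_val (cast_ord eJ j)) = \prod_(k in J) F k.
Proof.
subst m; rewrite [RHS]big_enum_val.
by apply: eq_bigr => j _; rewrite cast_ord_id.
Qed.

Lemma minor_diag_mul (K : comNzRingType) (n : nat) (x y : 'rV[K]_n)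
    (A : 'M[K]_n) (I J : {set 'I_n}) : #|I| = #|J| ->
  minor (diag_mx x *m A *m diag_mx y) I J =
  (\prod_(i in I) x 0 i) * minor A I J * (\prod_(j in J) y 0 j).
Proof.
move=> eIJ; rewrite !(minor_cast _ erefl eIJ).
rewrite -(prod_enum_val_cast erefl) -(prod_enum_val_cast eIJ).
set A' := \matrix_(i, j) A _ _.
transitivity (\det (diag_mx (\row_i x 0 (enum_val (cast_ord (erefl #|I|) i)))
   *m A' *m diag_mx (\row_j y 0 (enum_val (cast_ord eIJ j))))).
  congr (\det _); apply/matrixP => i j.
  by rewrite mul_mx_diag mxE mul_mx_diag mxE mul_diag_mx mxE mul_diag_mx !mxE.
rewrite !det_mulmx !det_diag.
by congr (_ * _ * _); apply: eq_bigr => i _; rewrite mxE.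
Qed.

Lemma minor_diag (K : comNzRingType) (n : nat) (x : 'rV[K]_n)
    (I : {set 'I_n}) : minor (diag_mx x) I I = \prod_(i in I) x 0 i.
Proof.
rewrite (minor_cast _ erefl erefl) -(prod_enum_val_cast erefl).
transitivity (\det (diag_mx (\row_i x 0 (enum_val (cast_ord (erefl #|I|) i))))).
  congr (\det _); apply/matrixP => i j; rewrite !mxE !cast_ord_id.
  by rewrite (inj_eq enum_val_inj).
by rewrite det_diag; apply: eq_bigr => i _; rewrite mxE.
Qed.

Lemma minor_adjoint (C : numClosedFieldType) (n : nat) (A : 'M[C]_n)
    (I J : {set 'I_n}) : #|I| = #|J| ->
  minor (A ^t*)%sesqui J I = (minor A I J)^*.
Proof.
move=> eIJ; rewrite (minor_cast _ eIJ erefl) (minor_cast A erefl eIJ).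
rewrite -det_map_mx -det_tr; congr (\det _).
by apply/matrixP => i j; rewrite !mxE.
Qed.

(** * The discrepancy as a polynomial on the torus *)

Lemma esym_gap_expansion (R : realType) (n r : nat) (U : 'M[R[i]]_n)
    (z w : 'I_n -> circle R) :
  esym_gap r U z w =
  \sum_(p : {set 'I_n} * {set 'I_n} | (#|p.1| == r) && (#|p.2| == r))
    (ComplexField.Normc.normc (minor U p.1 p.2) ^+ 2 - 'C(n, r)%:R^-1)%:C%C *
    ((\prod_(i in p.1) cval (z i)) * (\prod_(j in p.2) cval (w j))).
Proof.
rewrite /esym_gap /e_ big_distrlr /= big_distrl /=.
under [X in _ - X]eq_bigr do rewrite big_distrl /=.
rewrite -sumrB -(pair_big_dep (fun I : {set 'I_n} => #|I| == r)
  (fun _ (J : {set 'I_n}) => #|J| == r)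
  (fun I J => (ComplexField.Normc.normc (minor U I J) ^+ 2
    - 'C(n, r)%:R^-1)%:C%C *
    ((\prod_(i in I) cval (z i)) * (\prod_(j in J) cval (w j))))) /=.
apply: eq_bigr => I /eqP cI.
rewrite minor_mulmx cI -sumrB; apply: eq_bigr => J /eqP cJ.
have cIJ : #|I| = #|J| by rewrite cI cJ.
rewrite minor_adjoint // /E_ minor_diag_mul // !minor_diag.
have rowE (x : 'I_n -> circle R) (K : {set 'I_n}) :
    \prod_(i in K) (\row_k cval (x k)) 0 i = \prod_(i in K) cval (x i).
  by apply: eq_bigr => k _; rewrite mxE.
rewrite !rowE.
set a := \prod_(i in I) _; set b := \prod_(j in J) _.
rewrite rmorphB rmorphXn /= fmorphV rmorph_nat.
(* The norm of R[i] is by definition the image of [normc]. *)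
rewrite [(ComplexField.Normc.normc _)%:C%C](_ : _ = `|minor U I J|) // normCK.
by rewrite mulrBl; congr (_ - _); ring.
Qed.

(** * Parseval's identity on the sign vectors *)

(** The characters of the group of sign vectors, a sign vector being given by
    the set s of its coordinates equal to -1: S indexes the character that
    multiplies the coordinates in S. *)
Definition walsh (K : pzRingType) (T : finType) (s S : {set T}) : K :=
  \prod_(k in S) (-1) ^+ (k \in s).

(** The sum over s of a product over coordinates factors as a product of sums
    over one sign; the factor at a coordinate on which S and S' differ is
    1 - 1. *)
Lemma walsh_orthogonal (K : comNzRingType) (T : finType) (S S' : {set T}) :
  \sum_(s : {set T}) walsh K s S * walsh K s S' = (2 ^+ #|T|) *+ (S == S').
Proof.
pose f k : K := (-1) ^+ (k \in S) * (-1) ^+ (k \in S').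
transitivity (\prod_(k : T) (f k + 1)).
  rewrite bigA_distr; apply: eq_bigr => s _; rewrite /walsh.
  rewrite !(big_mkcond (fun k => k \in _)) -big_split /=; apply: eq_bigr => k _.
  by rewrite /f; case: (k \in S); case: (k \in S'); case: (k \in s);
    rewrite /= ?expr0 ?expr1 ?mulr1.
have [eS|neS] := eqVneq S S'.
  rewrite (eq_bigr (fun=> 2)) ?prodr_const // => k _.
  by rewrite /f eS -signr_addb addbb.
(* k separates S and S', so f k = -1. *)
have [k kS] : exists k, (k \in S) != (k \in S').
  by apply/existsP; apply: contra_neqT neS => /existsPn eS; apply/setP => k;
    apply/eqP; rewrite -[_ == _]negbK.
rewrite mulr0n (bigD1 k) //= /f.
by case: (k \in S) kS; case: (k \in S') => // _;
  rewrite ?expr0 ?expr1 ?mulr1 ?mul1r addNr mul0r.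
Qed.

Lemma walsh_parseval (C : numClosedFieldType) (T p : finType) (P : pred p)
    (S : p -> {set T}) (a : p -> C) : injective S ->
  \sum_(s : {set T}) `|\sum_(q | P q) walsh C s (S q) * a q| ^+ 2 =
  2 ^+ #|T| * \sum_(q | P q) `|a q| ^+ 2.
Proof.
move=> S_inj.
have walshJ s q : (walsh C s (S q))^* = walsh C s (S q).
  by rewrite /walsh rmorph_prod; apply: eq_bigr => k _; rewrite rmorph_sign.
under eq_bigr => s _ do rewrite normCK rmorph_sum big_distrlr /=.
rewrite exchange_big big_distrr /=; apply: eq_bigr => q Pq.
rewrite exchange_big /= (bigD1 q) //= [X in _ + X]big1 ?addr0.
  transitivity (\sum_s walsh C s (S q) * walsh C s (S q) * (a q * (a q)^*)).
    by apply: eq_bigr => s _; rewrite rmorphM /= walshJ mulrACA.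
  by rewrite -big_distrl /= walsh_orthogonal eqxx mulr1n normCK.
move=> q' /andP[_ neq].
transitivity (\sum_s walsh C s (S q) * walsh C s (S q') * (a q * (a q')^*)).
  by apply: eq_bigr => s _; rewrite rmorphM /= walshJ mulrACA.
by rewrite -big_distrl /= walsh_orthogonal (inj_eq S_inj) eq_sym (negPf neq)
  mulr0n mul0r.
Qed.

Definition torus_poly (R : realType) (m : nat) (p : finType) (P : pred p)
    (S : p -> {set 'I_m}) (c : p -> R[i]) (t : m.-tuple (circle R)) : R[i] :=
  \sum_(q | P q) c q * \prod_(k in S q) cval (tnth t k).

Lemma normr_sign_circle (R : realType) (b : bool) : `|(-1) ^+ b : R[i]| == 1.
Proof. by rewrite normr_sign. Qed.

Definition sign_torus (R : realType) (m : nat) (s : {set 'I_m}) :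
    m.-tuple (circle R) :=
  [tuple Circle (normr_sign_circle R (k \in s)) | k < m].

Lemma torus_poly_sign (R : realType) (m : nat) (p : finType) (P : pred p)
    (S : p -> {set 'I_m}) (c : p -> R[i]) (s : {set 'I_m})
    (t : m.-tuple (circle R)) :
  torus_poly P S c (torus_mul (sign_torus R s) t) =
  \sum_(q | P q) walsh _ s (S q) * (c q * \prod_(k in S q) cval (tnth t k)).
Proof.
apply: eq_bigr => q _; rewrite mulrCA; congr (_ * _).
rewrite /walsh -big_split /=; apply: eq_bigr => k _.
by rewrite !tnth_mktuple.
Qed.

(** Translating t by a sign vector s multiplies each monomial by the value at s
    of a Walsh character, distinct monomials giving distinct characters, and the
    monomials have modulus 1 at t: the sum over s does not depend on t. *)
Lemma sum_sign_torus_poly (R : realType) (m : nat) (p : finType) (P : pred p)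
    (S : p -> {set 'I_m}) (c : p -> R[i]) (t : m.-tuple (circle R)) :
  injective S ->
  \sum_(s : {set 'I_m}) ComplexField.Normc.normc
    (torus_poly P S c (torus_mul (sign_torus R s) t)) ^+ 2 =
  2 ^+ m * \sum_(q | P q) ComplexField.Normc.normc (c q) ^+ 2.
Proof.
move=> S_inj; apply: (@complexI R).
have normE (x : R[i]) :
    ((ComplexField.Normc.normc x) ^+ 2)%:C%C = `|x| ^+ 2 by rewrite rmorphXn.
rewrite rmorphM rmorphXn rmorph_nat !rmorph_sum /=.
under eq_bigr do rewrite normE torus_poly_sign.
rewrite walsh_parseval // card_ord; congr (_ * _); apply: eq_bigr => q _.
rewrite normE normrM normr_prod big1 ?mulr1 // => k _.
exact/eqP/(valP (tnth t k)).
Qed.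

(** * Measurability of complex-valued functions *)

(** Borel measurability for C = R^2, coordinate by coordinate. *)
Definition complex_measurable_fun (R : realType) (d : measure_display)
    (T : measurableType d) (f : T -> R[i]) : Prop :=
  measurable_fun setT (fun t => complex.Re (f t)) /\
  measurable_fun setT (fun t => complex.Im (f t)).

Lemma complex_measurable_cst (R : realType) (d : measure_display)
    (T : measurableType d) (c : R[i]) :
  complex_measurable_fun (fun _ : T => c).
Proof. by split; exact: measurable_cst. Qed.

Lemma complex_measurableD (R : realType) (d : measure_display)
    (T : measurableType d) (f g : T -> R[i]) :
  complex_measurable_fun f -> complex_measurable_fun g ->
  complex_measurable_fun (fun t => f t + g t).
Proof.
move=> [f1 f2] [g1 g2]; split.
  rewrite (_ : (fun _ => _) =
    (fun t => complex.Re (f t) + complex.Re (g t))); last first.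
    by apply/funext => t; case: (f t); case: (g t).
  exact: measurable_funD.
rewrite (_ : (fun _ => _) =
  (fun t => complex.Im (f t) + complex.Im (g t))); last first.
  by apply/funext => t; case: (f t); case: (g t).
exact: measurable_funD.
Qed.

Lemma complex_measurableM (R : realType) (d : measure_display)
    (T : measurableType d) (f g : T -> R[i]) :
  complex_measurable_fun f -> complex_measurable_fun g ->
  complex_measurable_fun (fun t => f t * g t).
Proof.
move=> [f1 f2] [g1 g2]; split.
  rewrite (_ : (fun _ => _) = (fun t => complex.Re (f t) * complex.Re (g t) -
    complex.Im (f t) * complex.Im (g t))); last first.
    by apply/funext => t; case: (f t); case: (g t).
  by apply: measurable_funB; apply: measurable_funM.
rewrite (_ : (fun _ => _) = (fun t => complex.Re (f t) * complex.Im (g t) +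
  complex.Im (f t) * complex.Re (g t))); last first.
  by apply/funext => t; case: (f t); case: (g t).
by apply: measurable_funD; apply: measurable_funM.
Qed.

Lemma complex_measurable_sum (R : realType) (d : measure_display)
    (T : measurableType d) (I : finType) (P : pred I) (f : I -> T -> R[i]) :
  (forall i, complex_measurable_fun (f i)) ->
  complex_measurable_fun (fun t => \sum_(i | P i) f i t).
Proof.
move=> mf; elim: (index_enum I) => [|i s IH].
  under eq_fun do rewrite big_nil; exact: complex_measurable_cst.
under eq_fun do rewrite big_cons.
by case: (P i) => //; exact: complex_measurableD.
Qed.

Lemma complex_measurable_prod (R : realType) (d : measure_display)
    (T : measurableType d) (I : finType) (P : pred I) (f : I -> T -> R[i]) :
  (forall i, complex_measurable_fun (f i)) ->
  complex_measurable_fun (fun t => \prod_(i | P i) f i t).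
Proof.
move=> mf; elim: (index_enum I) => [|i s IH].
  under eq_fun do rewrite big_nil; exact: complex_measurable_cst.
under eq_fun do rewrite big_cons.
by case: (P i) => //; exact: complex_measurableM.
Qed.

Lemma measurable_normc_sqr (R : realType) (d : measure_display)
    (T : measurableType d) (f : T -> R[i]) :
  complex_measurable_fun f ->
  measurable_fun setT (fun t => ComplexField.Normc.normc (f t) ^+ 2).
Proof.
move=> [f1 f2]; rewrite (_ : (fun _ => _) =
    (fun t => complex.Re (f t) ^+ 2 + complex.Im (f t) ^+ 2)).
  by apply: measurable_funD; apply: measurable_funX.
apply/funext => t; case: (f t) => x y /=.
by rewrite sqr_sqrtr // addr_ge0 // sqr_ge0.
Qed.

(** Measurability on the circle is defined through its two real coordinates, so
    maps to the circle can be treated as complex-valued functions. *)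
Lemma measurable_fun_circleP (R : realType) (d : measure_display)
    (T : measurableType d) (f : T -> circle R) :
  measurable_fun setT f <-> complex_measurable_fun (fun t => cval (f t)).
Proof.
have mcoord : measurable_fun setT (@circle_coord R).
  by move=> _ B mB; rewrite setTI; exists B => //; rewrite setTI.
split=> [mf|[m1 m2]].
  have mcf : measurable_fun setT (@circle_coord R \o f).
    exact: measurableT_comp.
  split.
    exact: (measurableT_comp measurable_fst mcf).
  exact: (measurableT_comp measurable_snd mcf).
move=> _ _ [B mB <-]; rewrite setTI setTI.
have /(_ measurableT _ mB) := measurable_fun_pair m1 m2.
by rewrite setTI.
Qed.

Lemma complex_measurable_tnth (R : realType) (m : nat) (k : 'I_m) :
  complex_measurable_fun (fun t : m.-tuple (circle R) => cval (tnth t k)).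
Proof.
apply: (measurable_fun_circleP (fun t : m.-tuple (circle R) => tnth t k)).1.
exact: measurable_tnth.
Qed.

Lemma measurable_circle_mul (R : realType) (u : circle R) :
  measurable_fun setT (circle_mul u).
Proof.
apply/measurable_fun_circleP; apply: complex_measurableM.
  exact: complex_measurable_cst.
by apply: (measurable_fun_circleP (fun x : circle R => x)).1.
Qed.

Lemma measurable_torus_mul (R : realType) (m : nat) (u : m.-tuple (circle R)) :
  measurable_fun setT (torus_mul u).
Proof.
apply/measurable_fun_tnthP => k.
rewrite (_ : _ \o _ = circle_mul (tnth u k) \o (fun t => tnth t k)).
  apply: measurableT_comp; first exact: measurable_circle_mul.
  exact: measurable_tnth.
by apply/funext => t /=; rewrite tnth_mktuple.
Qed.

Lemma measurable_torus_poly (R : realType) (m : nat) (p : finType)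
    (P : pred p) (S : p -> {set 'I_m}) (c : p -> R[i]) :
  measurable_fun setT
    (fun t => ComplexField.Normc.normc (torus_poly P S c t) ^+ 2).
Proof.
apply: measurable_normc_sqr; apply: complex_measurable_sum => q.
apply: complex_measurableM; first exact: complex_measurable_cst.
by apply: complex_measurable_prod => k; exact: complex_measurable_tnth.
Qed.

(** * Parseval's identity for Haar measure on the torus *)

Lemma integral_haar_translate (R : realType) (d : measure_display)
    (G : measurableType d) (mul : G -> G -> G) (mu : probability G R)
    (u : G) (F : G -> \bar R) :
  is_haar mul mu -> measurable_fun setT (mul u) -> measurable_fun setT F ->
  (forall t, 0 <= F t)%E ->
  (\int[mu]_t F (mul u t) = \int[mu]_t F t)%E.
Proof.
move=> mu_haar mmul mF F0.
transitivity (\int[pushforward mu (mul u)]_t F t)%E.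
  by rewrite ge0_integral_pushforward.
by apply: eq_measure_integral => A mA _; exact: mu_haar.
Qed.

(** The integral equals its average over the translations by the 2^m sign
    vectors, and the average of the integrands is constant. *)
Lemma torus_parseval (R : realType) (m : nat)
    (mu : probability (m.-tuple (circle R)) R) (p : finType) (P : pred p)
    (S : p -> {set 'I_m}) (c : p -> R[i]) :
  is_haar (@torus_mul R m) mu -> injective S ->
  (\int[mu]_t (ComplexField.Normc.normc (torus_poly P S c t) ^+ 2)%:E =
   (\sum_(q | P q) ComplexField.Normc.normc (c q) ^+ 2)%:E)%E.
Proof.
move=> mu_haar S_inj.
pose F t := (ComplexField.Normc.normc (torus_poly P S c t) ^+ 2)%:E.
have mF : measurable_fun setT F.
  by apply/measurable_EFinP; exact: measurable_torus_poly.
have F0 t : (0 <= F t)%E by rewrite lee_fin sqr_ge0.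
have mFs s : measurable_fun setT (fun t => F (torus_mul (sign_torus R s) t)).
  by apply: measurableT_comp => //; exact: measurable_torus_mul.
pose N : R := 2 ^+ m.
have N0 : 0 < N by rewrite exprn_gt0.
have : (N%:E * \int[mu]_t F t =
    (N * \sum_(q | P q) ComplexField.Normc.normc (c q) ^+ 2)%:E)%E.
  transitivity (\sum_(s : {set 'I_m})
      \int[mu]_t F (torus_mul (sign_torus R s) t))%E.
    rewrite (eq_bigr (fun=> 1%:E * \int[mu]_t F t)%E); last first.
      move=> s _; rewrite mul1e; apply: integral_haar_translate => //.
      exact: measurable_torus_mul.
    rewrite -ge0_sume_distrl // sumEFin sumr_const; congr (_%:E * _)%E.
    rewrite -[#|_|]/#|{: {set 'I_m}}| -cardsT -powersetT.
    by rewrite card_powerset cardsT card_ord natrX.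
  rewrite -ge0_integral_sum //.
  rewrite (eq_integral (cst (N * \sum_(q | P q)
    ComplexField.Normc.normc (c q) ^+ 2)%:E)).
    by rewrite integral_cst //= probability_setT mule1.
  by move=> t _ /=; rewrite sumEFin sum_sign_torus_poly.
(* The integral is not known to be finite beforehand: the infinite values
   are ruled out by the equation itself. *)
rewrite -/F; case: (\int[mu]_t F t)%E => [x| |] /=.
- by rewrite -EFinM => -[] /(mulfI (lt0r_neq0 N0)) ->.
- by rewrite gt0_muley ?lte_fin.
- by rewrite gt0_muleNy ?lte_fin.
Qed.

(** * The joint law of independent Haar variables *)

Definition box (T : Type) (m : nat) (A : 'I_m -> set T) : set (m.-tuple T) :=
  [set t | forall k, A k (tnth t k)].

Lemma measurable_tuple_box (d : measure_display) (T : measurableType d)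
    (m : nat) :
  (measurable : set (set (m.-tuple T))) =
  <<s [set box A | A in [set A | forall k, measurable (A k)]] >>.
Proof.
apply/seteqP; split; last first.
  apply: smallest_sub; first exact: sigma_algebra_measurable.
  move=> _ [A mA <-].
  rewrite (_ : box A =
    \bigcap_(k in [set: 'I_m]) ((fun t => tnth t k) @^-1` A k)).
    apply: fin_bigcap_measurable => // k _; rewrite -[X in measurable X]setTI.
    by apply: measurable_tnth => //; exact: mA.
  by apply/seteqP; split=> [t At k _|t At k]; exact: At.
apply: smallest_sub; first exact: smallest_sigma_algebra.
rewrite -bigcup_seq => _ [k _ [A mA <-]]; apply: sub_sigma_algebra.
exists (fun j => if j == k then A else setT).
  by move=> j; case: ifP.
apply/seteqP; split=> [t /(_ k)|t [_ /= At] j]; first by rewrite eqxx; split.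
by case: eqP => // ->.
Qed.

(** By uniqueness of measures on the pi-system of boxes it suffices to translate
    boxes.  A translated box is a box, so independence reduces the claim to the
    invariance of each marginal law. *)
Lemma joint_haar (R : realType) (d : measure_display) (T : measurableType d)
    (P : probability T R) (m : nat) (X : 'I_m -> {RV P >-> circle R})
    (Y : {RV P >-> m.-tuple (circle R)}) :
  (forall t k, tnth (Y t) k = X k t) ->
  (forall A : 'I_m -> set (circle R), (forall k, measurable (A k)) ->
    P (\bigcap_k (X k @^-1` A k)) = (\prod_k P (X k @^-1` A k))%E) ->
  (forall k, is_haar (@circle_mul R) (distribution P (X k))) ->
  is_haar (@torus_mul R m) (distribution P Y).
Proof.
move=> YX indep X_haar u B mB.
have mu := measurable_torus_mul u.
have boxE A : Y @^-1` box A = \bigcap_k (X k @^-1` A k).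
  apply/seteqP; split=> [t At k _|t At k] /=.
    by rewrite -YX; exact: At.
  by rewrite YX; exact: At.
apply: (@measure_unique _ _ _ _ (fun=> setT)
  (@measurable_tuple_box _ (circle R) m) _ _ _
  (pushforward (distribution P Y) (torus_mul u)) (distribution P Y)) => //.
- move=> _ _ [A mA <-] [A' mA' <-]; exists (fun k => A k `&` A' k).
    by move=> k; exact: measurableI.
  apply/seteqP; split=> [t At|t [At A't] k].
    by split=> k; have [] := At k.
  by split; [exact: At|exact: A't].
- move=> _; exists (fun=> setT) => //.
  by apply/seteqP; split.
- by rewrite bigcup_const.
- move=> _ [A mA <-].
  have uA k : measurable (circle_mul (tnth u k) @^-1` A k).
    rewrite -[X in measurable X]setTI.
    by apply: measurable_circle_mul => //; exact: mA.
  have uboxE : torus_mul u @^-1` box A =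
      box (fun k => circle_mul (tnth u k) @^-1` A k).
    by apply/seteqP; split=> t /= At k; have := At k; rewrite tnth_mktuple.
  transitivity (P (Y @^-1` (torus_mul u @^-1` box A))); first by [].
  transitivity (P (Y @^-1` box A)); last by [].
  rewrite uboxE !boxE !indep //.
  by apply: eq_bigr => k _; exact: X_haar.
- have PT : (P setT < +oo)%E by rewrite probability_setT ltry.
  by move=> _; exact: PT.
Qed.

(** * The discrepancy identity *)

(** The exponent of the monomial z_I w_J in the 2n variables (z, w). *)
Definition joint_support (n : nat) (p : {set 'I_n} * {set 'I_n}) :
    {set 'I_(n + n)} :=
  [set k | match fintype.split k with
           | inl i => i \in p.1
           | inr j => j \in p.2
           end]%SET.

Lemma joint_support_inj (n : nat) : injective (@joint_support n).
Proof.
move=> [I J] [I' J'] /setP eS; congr pair; apply/setP => i.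
  by have := eS (lshift n i); rewrite !inE (unsplitK (inl i)).
by have := eS (rshift n i); rewrite !inE (unsplitK (inr i)).
Qed.

Lemma prod_joint_support (K : comNzRingType) (n : nat)
    (p : {set 'I_n} * {set 'I_n}) (f : 'I_(n + n) -> K) :
  \prod_(k in joint_support p) f k =
  (\prod_(i in p.1) f (lshift n i)) * (\prod_(j in p.2) f (rshift n j)).
Proof.
rewrite big_split_ord; congr (_ * _); apply: eq_bigl => i.
  by rewrite inE (unsplitK (inl i)).
by rewrite inE (unsplitK (inr i)).
Qed.

(** Measurability is part of the conclusion because the change of variables from
    an arbitrary probability space to the torus needs it. *)
Lemma haar_esym_gap (R : realType) (n r : nat) (U : 'M[R[i]]_n)
    (mu : probability ((n + n).-tuple (circle R)) R) :
  is_haar (@torus_mul R (n + n)) mu ->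
  let F t := (ComplexField.Normc.normc
    (esym_gap r U (fun i => tnth t (lshift n i))
                  (fun j => tnth t (rshift n j))) ^+ 2)%:E in
  measurable_fun setT F /\ (\int[mu]_t F t = (delta r U)%:E)%E.
Proof.
move=> mu_haar F.
pose c (p : {set 'I_n} * {set 'I_n}) : R[i] :=
  (ComplexField.Normc.normc (minor U p.1 p.2) ^+ 2 - 'C(n, r)%:R^-1)%:C%C.
pose P (p : {set 'I_n} * {set 'I_n}) := (#|p.1| == r) && (#|p.2| == r).
have -> : F = fun t => (ComplexField.Normc.normc
    (torus_poly P (@joint_support n) c t) ^+ 2)%:E.
  apply/funext => t; congr (ComplexField.Normc.normc _ ^+ 2)%:E.
  rewrite esym_gap_expansion; apply: eq_bigr => p _.
  by rewrite prod_joint_support.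
split; first by apply/measurable_EFinP; exact: measurable_torus_poly.
rewrite torus_parseval //; last exact: joint_support_inj.
rewrite /delta pair_big_dep /=; congr EFin; apply: eq_bigr => p _.
by rewrite /c /= expr0n addr0 sqr_sqrtr // sqr_ge0.
Qed.

Theorem theorem4p6 (R : realType) (n : nat) (hn : (1 <= n)%N)
    (U : 'M[R[i]]_n) (hU : U \is unitarymx) (r : nat) (hr : (r <= n)%N) :
  (forall (d : measure_display) (T : measurableType d) (P : probability T R)
      (z w : 'I_n -> {RV P >-> circle R}),
    mutually_independent
      (fun k : 'I_n + 'I_n => match k with inl i => z i | inr j => w j end) ->
    (forall i, is_haar (@circle_mul R) (distribution P (z i))) ->
    (forall j, is_haar (@circle_mul R) (distribution P (w j))) ->
    (delta r U)%:E =
    ('E_P[(fun t => ComplexField.Normc.normc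
             (esym_gap r U (fun i => z i t) (fun j => w j t)) ^+ 2)%R])%E) /\
  (forall mu : probability ((n + n).-tuple (circle R)) R,
    is_haar (@torus_mul R (n + n)) mu ->
    (delta r U)%:E =
    ('N[mu]_(2%:E)[(fun t => (ComplexField.Normc.normc
             (esym_gap r U (fun i => tnth t (lshift n i))
                           (fun j => tnth t (rshift n j))))%:E)] ^+ 2)%E).
Proof.
split=> [d T P z w indep z_haar w_haar|mu mu_haar].
- pose X (k : 'I_(n + n)) : {RV P >-> circle R} :=
    match fintype.split k with inl i => z i | inr j => w j end.
  pose Y t := [tuple X k t | k < n + n].
  have mY : measurable_fun setT Y.
    apply/measurable_fun_tnthP => k.
    rewrite (_ : _ \o _ = X k); first exact: measurable_funPT.
    by apply/funext => t /=; rewrite tnth_mktuple.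
  pose Ym : {RV P >-> (n + n).-tuple (circle R)} :=
    HB.pack Y (isMeasurableFun.Build _ _ _ _ Y mY).
  have Y_haar : is_haar (@torus_mul R (n + n)) (distribution P Ym).
    apply: (@joint_haar _ _ _ _ _ X).
    + by move=> t k; rewrite tnth_mktuple.
    + move=> A mA.
      have := indep [set: 'I_n + 'I_n]%SET (fun k => A (unsplit k))
        (fun k => mA (unsplit k)).
      rewrite (reindex (@fintype.split n n)) /=; last first.
        by exists (@unsplit n n) => k _; [exact: splitK|exact: unsplitK].
      rewrite (eq_bigl predT) => [|k]; last by rewrite inE.
      under eq_bigr do rewrite splitK.
      move=> <-; congr (P _); apply/seteqP; split=> [t Xt k _|t Xt k _].
        by have := Xt (unsplit k) I; rewrite /X unsplitK.
      by have := Xt (fintype.split k); rewrite /= inE splitK; apply.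
    + by move=> k; rewrite /X; case: (fintype.split k).
  have [mF <-] := haar_esym_gap r U Y_haar.
  rewrite (ge0_integral_distribution _ mF); last first.
    by move=> y; rewrite lee_fin sqr_ge0.
  rewrite expectation.unlock.
  have YE t : (fun i => tnth (Ym t) (lshift n i)) = (fun i => z i t) /\
      (fun j => tnth (Ym t) (rshift n j)) = (fun j => w j t).
    split; apply/funext => i; rewrite tnth_mktuple /X.
      by rewrite (unsplitK (inl i)).
    by rewrite (unsplitK (inr i)).
  apply: eq_integral => t _.
  rewrite [LHS]/comp.
  have [-> ->] := YE t.
  by [].
- have [_ <-] := haar_esym_gap r U mu_haar.
  rewrite Lnorm.unlock /Lnorm.body poweR12_sqrt; last first.
    by apply: integral_ge0 => t _; exact: poweR_ge0.
  rewrite sqr_sqrte; last by apply: integral_ge0 => t _; exact: poweR_ge0.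
  apply: eq_integral => t _; rewrite /= ger0_norm; last first.
    by case: (esym_gap _ _ _ _) => x y; exact: sqrtr_ge0.
  by rewrite powR_mulrn //; case: (esym_gap _ _ _ _) => x y; exact: sqrtr_ge0.
Qed.
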